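(* Let $M(z)=D+C(zI_n-A)^{-1}B$ be a $p\times p$ matrix-valued rational function, where $A\in\mathbb C^{n\times n}$, $B\in\mathbb C^{n\times p}$, $C\in\mathbb C^{p\times n}$, $D\in\mathbb C^{p\times p}$, and suppose that $\|M(z)\|\le 1$ for all $z$ in the unit circle $\mathbb T$. Assume that \[ \lim_{k\to\infty}\|D^k\|^{1/k}<1 . \] Then: (i) The operators \[ \mathscr A=\begin{pmatrix} A & BC & BDC & BD^2C & \cdots \\ 0 & A & BC & BDC & \cdots \\ 0 & 0 & A & BC & \cdots \\ \vdots & \vdots & \vdots & \vdots & \ddots \end{pmatrix}:\ \ell_2(\mathbb N)\otimes\mathbb C^n\to\ell_2(\mathbb N)\otimes\mathbb C^n, \] \[ \mathscr B=\begin{pmatrix} \vdots \\ BD^2 \\ BD \\ B \end{pmatrix}:\ \mathbb C^p\to\ell_2(\mathbb N)\otimes\mathbb C^n,\qquad \mathscr C=\begin{pmatrix} C & DC & D^2C & \cdots \end{pmatrix}:\ \ell_2(\mathbb N)\otimes\mathbb C^n\to\mathbb C^p \] are bounded. (ii) $\mathscr A$ is the block-Toeplitz operator with symbol $A+zB(I-zD)^{-1}C$.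
   Context: $\mathbb T=\{z\in\mathbb C:|z|=1\}$. The block column $\mathscr B$ has entries $B,BD,BD^2,\ldots$ read from bottom to top, so that the $\ell_2$-index of the entry $BD^k$ counts from the bottom. The block-Toeplitz operator on $\ell_2(\mathbb N)\otimes\mathbb C^n$ with symbol $\phi(z)=\sum_{k}\phi_kz^k$ ($z\in\mathbb T$, $\phi_k\in\mathbb C^{n\times n}$) is, in the convention used here, the operator whose $(i,j)$ block is $\phi_{j-i}$ (so a symbol with only non-negative powers of $z$ gives a block upper triangular operator). *)

(* Defs.v *)
From HB Require Import structures.
From mathcomp Require Import all_boot all_order all_algebra.
From mathcomp Require Import complex.
From mathcomp Require Import all_classical all_reals all_analysis.

Set Implicit Arguments.
Unset Strict Implicit.
Unset Printing Implicit Defensive.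

Import Order.TTheory GRing.Theory Num.Theory.
Import numFieldNormedType.Exports.

Local Open Scope classical_set_scope.
Local Open Scope complex_scope.
Local Open Scope ring_scope.

(* The modulus topology is inferred on an abstract [numClosedFieldType] but not
   on the concrete type [R[i]], where these instances declare it. *)
#[non_forgetful_inheritance]
HB.instance Definition _ (R : realType) :=
  PseudoPointedMetric.copy R[i] (R[i] : numClosedFieldType)^o.
#[non_forgetful_inheritance]
HB.instance Definition _ (R : realType) :=
  NormedModule.copy R[i] (R[i] : numClosedFieldType)^o.

Section Norms.
Variable R : realType.

Definition vnorm n (v : 'cV[R[i]]_n) : R :=
  Num.sqrt (\sum_(k < n) Normc.normc (v k ord0) ^+ 2).

Definition opnorm m n (M : 'M[R[i]]_(m, n)) : R :=
  sup [set vnorm (M *m v) | v in [set v : 'cV[R[i]]_n | vnorm v <= 1]].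

(* The space l_2(N) (x) C^n consists of the sequences of vectors of C^n whose
   extended-real-valued norm [l2norm] is finite. *)
Definition l2norm n (x : nat -> 'cV[R[i]]_n) : \bar R :=
  sqrte (\sum_(0 <= k <oo) ((vnorm (x k)) ^+ 2)%:E)%E.

Definition vnorme n (v : 'cV[R[i]]_n) : \bar R := (vnorm v)%:E.

(* [NU] and [NV] are extended-real-valued: the operator is considered between
   the normed spaces [NU < +oo] and [NV < +oo]; the inequality forces [f x] to
   have finite norm. *)
Definition bounded_operator (U V : lmodType R[i])
    (NU : U -> \bar R) (NV : V -> \bar R) (f : U -> V) : Prop :=
  (forall (a : R[i]) (x y : U), (NU x < +oo)%E -> (NU y < +oo)%E ->
     f (a *: x + y) = a *: f x + f y) /\
  (exists K : R, forall x : U, (NU x < +oo)%E -> (NV (f x) <= K%:E * NU x)%E).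

End Norms.

Section BlockRows.
Variables (R : realType) (m n : nat).
Implicit Types (r : nat -> 'M[R[i]]_(m, n)) (x : nat -> 'cV[R[i]]_n).

Definition row_apply r x : 'cV[R[i]]_m := limn (series (fun j => r j *m x j)).

(* [limn] takes an arbitrary value on a divergent sequence, hence this separate
   convergence predicate. *)
Definition row_defined r : Prop :=
  forall x, (l2norm x < +oo)%E -> cvgn (series (fun j => r j *m x j)).

End BlockRows.

Section Realization.
Variables (R : realType) (n p : nat).
Variables (A : 'M[R[i]]_n) (B : 'M[R[i]]_(n, p)).
Variables (C : 'M[R[i]]_(p, n)) (D : 'M[R[i]]_p).

Definition scrA_block (i j : nat) : 'M[R[i]]_n :=
  if (j < i)%N then 0
  else if (j == i)%N then A
  else B *m D ^+ (j - i).-1 *m C.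

Definition scrA (x : nat -> 'cV[R[i]]_n) : nat -> 'cV[R[i]]_n :=
  fun i => row_apply (scrA_block i) x.

Definition scrB (u : 'cV[R[i]]_p) : nat -> 'cV[R[i]]_n :=
  fun k => B *m D ^+ k *m u.

Definition scrC_block (k : nat) : 'M[R[i]]_(p, n) := D ^+ k *m C.

Definition scrC (x : nat -> 'cV[R[i]]_n) : 'cV[R[i]]_p :=
  row_apply scrC_block x.

End Realization.

Section Toeplitz.
Variables (R : realType) (n : nat).

(* phi(z) = \sum_(k in Z) c_k z^k on the unit circle: both the non-negative and
   the negative halves converge. Such a family [c] is determined by [phi]. *)
Definition symbol_expansion (phi : R[i] -> 'M[R[i]]_n)
    (c : int -> 'M[R[i]]_n) : Prop :=
  forall z : R[i], `|z| = 1 ->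
    exists s t : 'M[R[i]]_n,
      [/\ series (fun k : nat => z ^+ k *: c k%:Z) @ \oo --> s,
          series (fun k : nat => z ^- k.+1 *: c (- k.+1%:Z)) @ \oo --> t
        & phi z = s + t].

Definition is_block_toeplitz (phi : R[i] -> 'M[R[i]]_n)
    (T : (nat -> 'cV[R[i]]_n) -> (nat -> 'cV[R[i]]_n)) : Prop :=
  exists2 c : int -> 'M[R[i]]_n, symbol_expansion phi c &
    forall x : nat -> 'cV[R[i]]_n, (l2norm x < +oo)%E -> forall i : nat,
      series (fun j : nat => c (j%:Z - i%:Z) *m x j) @ \oo --> T x i.

End Toeplitz.

(* Main.v *)
(** The spectral radius hypothesis makes the entries of [D ^ k] decay
    geometrically, [|(D ^ k)_(a, b)| <= K r ^ k] with [r < 1], so the blocks of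
    all three operators are dominated entrywise by weights whose row and column
    sums are bounded. Boundedness is then Schur's test, proved on finite
    sections by a weighted Cauchy-Schwarz inequality and extended by passing to
    the limit entrywise. The symbol comes from the Neumann series
    [(I - z D)^-1 = \sum_k z ^ k D ^ k], which converges on the unit circle. *)

Require Import Defs.
From mathcomp Require Import all_boot all_order all_algebra.
From mathcomp Require Import complex.
From mathcomp Require Import all_classical all_reals all_analysis.
From mathcomp Require Import lra ring.

Set Implicit Arguments.
Unset Strict Implicit.
Unset Printing Implicit Defensive.

Import Order.TTheory GRing.Theory Num.Theory.
Import numFieldNormedType.Exports.

Local Open Scope classical_set_scope.
Local Open Scope complex_scope.
Local Open Scope ring_scope.

Local Notation normc := Normc.normc.

(** * Entrywise convergence of complex matrices and of their series *)

Section Limits.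

Lemma cvg_mxP (T : topologicalType) (m n : nat) (u : nat -> 'M[T]_(m, n))
    (M : 'M[T]_(m, n)) :
  u @ \oo --> M <-> forall i j, u k i j @[k --> \oo] --> M i j.
Proof.
split=> [uM i j P MP|uM P [Q MQ QP]].
  apply: (uM [set N | P (N i j)]).
  (* This family of neighbourhoods constrains the entry [(i, j)] only and leaves every other entry
     free. The converse direction intersects the finitely many entrywise conditions. *)
  exists (fun i' j' => [set z | (i' == i) && (j' == j) -> P z]) => [i' j'|N /=].
    have [/andP[/eqP -> /eqP ->]|_] := boolP ((i' == i) && (j' == j)).
      by apply: filterS MP => z Pz _.
    by apply: filterS filterT => z _.
  by apply; rewrite !eqxx.
have H : \forall k \near \oo, forall i j, Q i j (u k i j).
  by do 2![apply: filter_forall => ?]; apply: uM; exact: MQ.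
by apply: filterS H => k Hk; apply: QP.
Qed.

Lemma cvg_sum (K : numFieldType) (V : normedModType K) (I : Type) (r : seq I)
    (P : pred I) (f : I -> nat -> V) (l : I -> V) :
  (forall i, P i -> f i @ \oo --> l i) ->
  \sum_(i <- r | P i) f i k @[k --> \oo] --> \sum_(i <- r | P i) l i.
Proof. by move=> fl; apply: cvg_big => //; exact: add_continuous. Qed.

Variable R : realType.
Implicit Types (z : R[i]) (u a : nat -> R[i]).

Lemma normc_ge0 z : 0 <= normc z.
Proof. by case: z => x y; exact: sqrtr_ge0. Qed.

Lemma sqr_normc_ReIm z : normc z ^+ 2 = complex.Re z ^+ 2 + complex.Im z ^+ 2.
Proof. by case: z => x y; rewrite sqr_sqrtr// addr_ge0 ?sqr_ge0. Qed.

Lemma Re_le_normc z : `|complex.Re z| <= normc z.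
Proof.
by rewrite -ler_sqr ?nnegrE ?normc_ge0// real_normK ?num_real//
  sqr_normc_ReIm lerDl sqr_ge0.
Qed.

Lemma Im_le_normc z : `|complex.Im z| <= normc z.
Proof.
by rewrite -ler_sqr ?nnegrE ?normc_ge0// real_normK ?num_real//
  sqr_normc_ReIm lerDr sqr_ge0.
Qed.

Lemma normc_le_ReIm z : normc z <= `|complex.Re z| + `|complex.Im z|.
Proof.
rewrite -ler_sqr ?nnegrE ?addr_ge0 ?normc_ge0//.
rewrite sqr_normc_ReIm sqrrD !real_normK ?num_real//.
by rewrite addrAC lerDl mulrn_wge0// mulr_ge0.
Qed.

Lemma ler_normc_sum (I : Type) (r : seq I) (P : pred I) (F : I -> R[i]) :
  normc (\sum_(k <- r | P k) F k) <= \sum_(k <- r | P k) normc (F k).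
Proof.
elim/big_ind2 : _ => [|x y x' y' yx y'x'|//]; first by rewrite Normc.normc0.
apply: le_trans (lerD yx y'x').
by rewrite -lecR rmorphD; exact: (@ler_normD _ R[i]).
Qed.

Lemma ltc_normc z (e : R) : (`|z| < e%:C) = (normc z < e).
Proof. exact: (ltcR (normc z) e). Qed.

(** The norm of [R[i]] takes its values in [R[i]]; this moves convergence to the real-valued
    modulus, where real analysis applies. *)
Lemma cvg_normcP u z : u @ \oo --> z <-> normc (z - u k) @[k --> \oo] --> 0.
Proof.
split=> [/cvgrPdist_lt uz|/cvgrPdist_lt uz]; apply/cvgrPdist_lt => e e0.
  have e0' : 0 < e%:C by rewrite ltcE /= eqxx.
  have := uz _ e0'; apply: filterS => k; rewrite ltc_normc => H.
  by rewrite sub0r normrN ger0_norm ?normc_ge0.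
(* A positive element of [R[i]] has zero imaginary part, so [e] is the embedding of a positive
   real. *)
have := e0; rewrite ltcE => /andP[/eqP Ie Re0].
have -> : e = (complex.Re e)%:C by case: e Ie {e0 Re0} => x y /= ->.
have := uz _ Re0; apply: filterS => k.
by rewrite sub0r normrN ger0_norm ?normc_ge0// -ltc_normc.
Qed.

Lemma cvg_complexP u z : u @ \oo --> z <->
  (complex.Re (u k) @[k --> \oo] --> complex.Re z) /\
  (complex.Im (u k) @[k --> \oo] --> complex.Im z).
Proof.
split=> [/cvg_normcP uz|[/cvgrPdist_lt uz /cvgrPdist_lt vz]].
  split; apply/cvgrPdist_lt => e e0; have /cvgrPdist_lt /(_ _ e0) := uz;
    apply: filterS => k; rewrite sub0r normrN (ger0_norm (normc_ge0 _));
    apply: le_lt_trans.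
  - by rewrite -raddfB Re_le_normc.
  - by rewrite -raddfB Im_le_normc.
apply/cvg_normcP/cvgrPdist_lt => e e0.
have e2 : 0 < e / 2 by rewrite divr_gt0.
near=> k; rewrite sub0r normrN ger0_norm ?normc_ge0//.
apply: le_lt_trans (normc_le_ReIm _) _; rewrite !raddfB [ltRHS]splitr ltrD//.
  by near: k; exact: uz.
by near: k; exact: vz.
Unshelve. all: by end_near. Qed.

(** The real and imaginary parts are dominated by [b] as well, so both converge absolutely as real
    series; the limit is assembled from theirs. *)
Lemma cvgn_series_dominated a (b : nat -> R) :
  (forall k, normc (a k) <= b k) -> cvgn (series b) -> cvgn (series a).
Proof.
move=> ab cb.
have b0 k : 0 <= b k by apply: le_trans (ab k); exact: normc_ge0.
have cRe : cvgn (series (fun k => complex.Re (a k))).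
  apply: normed_cvg; apply: series_le_cvg cb => //= k.
  exact: le_trans (Re_le_normc (a k)) (ab k).
have cIm : cvgn (series (fun k => complex.Im (a k))).
  apply: normed_cvg; apply: series_le_cvg cb => //= k.
  exact: le_trans (Im_le_normc (a k)) (ab k).
apply/cvg_ex; exists (Complex (limn (series (fun k => complex.Re (a k))))
                  (limn (series (fun k => complex.Im (a k))))).
apply/cvg_complexP; split => /=.
- by under eq_fun do rewrite raddf_sum; exact: cRe.
- by under eq_fun do rewrite raddf_sum; exact: cIm.
Qed.

Lemma cvg_mulmx (m n q : nat) (u : nat -> 'M[R[i]]_(m, n)) (M : 'M[R[i]]_(m, n))
    (v : nat -> 'M[R[i]]_(n, q)) (N : 'M[R[i]]_(n, q)) :
  u @ \oo --> M -> v @ \oo --> N -> (fun k => u k *m v k) @ \oo --> M *m N.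
Proof.
move=> /cvg_mxP uM /cvg_mxP vN; apply/cvg_mxP => i j.
rewrite mxE; under eq_fun do rewrite mxE.
by apply: cvg_sum => b _; apply: cvgM; [exact: uM|exact: vN].
Qed.

Lemma cvg_mx_unique (m n : nat) (u : nat -> 'M[R[i]]_(m, n))
    (M N : 'M[R[i]]_(m, n)) :
  u @ \oo --> M -> u @ \oo --> N -> M = N.
Proof.
move=> /cvg_mxP uM /cvg_mxP uN; apply/matrixP => i j.
exact: cvg_unique (uM i j) (uN i j).
Qed.

Lemma cvg_mx_linear (m n : nat) (u v : nat -> 'M[R[i]]_(m, n))
    (M N : 'M[R[i]]_(m, n)) z :
  u @ \oo --> M -> v @ \oo --> N ->
  (fun k => z *: u k + v k) @ \oo --> z *: M + N.
Proof.
move=> /cvg_mxP uM /cvg_mxP vN; apply/cvg_mxP => i j.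
rewrite !mxE; under eq_fun do rewrite !mxE.
by apply: cvgD; [apply: cvgMr; exact: uM|exact: vN].
Qed.

Lemma series_mxE (m n : nat) (u : nat -> 'M[R[i]]_(m, n)) k i j :
  series u k i j = series (fun k => u k i j) k.
Proof. exact: summxE. Qed.

Lemma cvgn_series_mx (m n : nat) (u : nat -> 'M[R[i]]_(m, n)) (b : nat -> R) :
  (forall k i j, normc (u k i j) <= b k) -> cvgn (series b) -> cvgn (series u).
Proof.
move=> ub cb; apply/cvg_ex.
exists (\matrix_(i, j) limn (series (fun k => u k i j))); apply/cvg_mxP => i j.
rewrite mxE; under eq_fun do rewrite series_mxE.
by apply: (@cvgn_series_dominated _ b).
Qed.

End Limits.

(** * Weighted Cauchy-Schwarz inequality and Schur's test *)

Section Estimates.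
Variable R : realType.

(* Lagrange's identity: the difference of the two sides is half of
   [\sum_(k, l) w k * w l * (t k - t l) ^+ 2]. *)
Lemma weighted_Cauchy_Schwarz (I : Type) (r : seq I) (w t : I -> R) :
  (forall k, 0 <= w k) ->
  (\sum_(k <- r) w k * t k) ^+ 2 <=
  (\sum_(k <- r) w k) * \sum_(k <- r) w k * t k ^+ 2.
Proof.
move=> w0.
have : 0 <= \sum_(k <- r) \sum_(l <- r) w k * w l * (t k - t l) ^+ 2.
  by apply: sumr_ge0 => k _; apply: sumr_ge0 => l _;
    rewrite mulr_ge0 ?sqr_ge0// mulr_ge0.
have -> : \sum_(k <- r) \sum_(l <- r) w k * w l * (t k - t l) ^+ 2 =
    \sum_(k <- r) \sum_(l <- r) (w k * (w l * t l ^+ 2)) +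
    \sum_(k <- r) \sum_(l <- r) (w k * t k ^+ 2 * w l) +
    \sum_(k <- r) \sum_(l <- r) (- 2 * (w k * t k)) * (w l * t l).
  rewrite -!big_split; apply: eq_bigr => k _ /=; rewrite -!big_split.
  by apply: eq_bigr => l _ /=; ring.
rewrite -!big_distrlr /= -mulr_sumr.
set a := \sum_(k <- r) w k; set b := \sum_(k <- r) w k * t k ^+ 2.
set c := \sum_(k <- r) w k * t k; lra.
Qed.

Lemma sqr_vnorm n (v : 'cV[R[i]]_n) :
  vnorm v ^+ 2 = \sum_(k < n) normc (v k ord0) ^+ 2.
Proof. by rewrite sqr_sqrtr// sumr_ge0// => k _; rewrite sqr_ge0. Qed.

Lemma vnorm_ge0 n (v : 'cV[R[i]]_n) : 0 <= vnorm v.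
Proof. exact: sqrtr_ge0. Qed.

Lemma normc_le_vnorm n (v : 'cV[R[i]]_n) k : normc (v k ord0) <= vnorm v.
Proof.
rewrite -ler_sqr ?nnegrE ?normc_ge0 ?vnorm_ge0// sqr_vnorm (bigD1 k)//=.
by rewrite lerDl sumr_ge0// => l _; rewrite sqr_ge0.
Qed.

Lemma normc_mulmx_le m n (M : 'M[R[i]]_(m, n)) (v : 'cV[R[i]]_n) a (w : R) :
  (forall b, normc (M a b) <= w) ->
  normc ((M *m v) a ord0) <= \sum_b w * normc (v b ord0).
Proof.
move=> Mw; rewrite mxE; apply: le_trans (ler_normc_sum _ _ _) _.
by apply: ler_sum => b _; rewrite Normc.normcM ler_wpM2r ?normc_ge0.
Qed.

(** Cauchy-Schwarz is applied to one output coordinate at a time, over all pairs of a block [j] and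
    a coordinate [b]. Each [w j] then occurs [n] times, which gives the factor [n]; summing over the
    output coordinates gives the factor [m]. *)
Lemma vnorm_block_row_le m n (T : nat -> 'M[R[i]]_(m, n))
    (x : nat -> 'cV[R[i]]_n) (w : nat -> R) M :
  (forall j a b, normc (T j a b) <= w j) -> (forall j, 0 <= w j) ->
  vnorm (\sum_(0 <= j < M) T j *m x j) ^+ 2 <=
  (m * n)%:R * (\sum_(0 <= j < M) w j) *
  \sum_(0 <= j < M) w j * vnorm (x j) ^+ 2.
Proof.
move=> Tw w0; rewrite sqr_vnorm.
set W := \sum_(0 <= j < M) w j; set S := \sum_(0 <= j < M) _ * _.
suff H a : normc ((\sum_(0 <= j < M) T j *m x j) a ord0) ^+ 2 <= n%:R * W * S.
  apply: le_trans (ler_sum _ (fun a _ => H a)) _.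
  by rewrite sumr_const card_ord natrM -[_ *+ m]mulr_natl !mulrA.
have -> : n%:R * W = \sum_(0 <= j < M) \sum_(b < n) w j.
  rewrite mulr_sumr; apply: eq_bigr => j _.
  by rewrite sumr_const card_ord mulr_natl.
have -> : S = \sum_(0 <= j < M) \sum_(b < n) w j * normc (x j b ord0) ^+ 2.
  by apply: eq_bigr => j _; rewrite sqr_vnorm mulr_sumr.
(* The double sum is flattened into a sum over a single list of pairs, the form that Cauchy-Schwarz
   takes. *)
pose r := [seq (j, b) | j <- index_iota 0 M, b <- index_enum 'I_n].
have rE (F : nat -> 'I_n -> R) :
    \sum_(0 <= j < M) \sum_(b < n) F j b = \sum_(q <- r) F q.1 q.2.
  by rewrite big_allpairs.
rewrite !rE; apply: le_trans _ (@weighted_Cauchy_Schwarz _ r (fun q => w q.1)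
  (fun q => normc (x q.1 q.2 ord0)) _) => //.
rewrite ler_sqr ?nnegrE ?normc_ge0 ?sumr_ge0// => [|q _]; last first.
  by rewrite mulr_ge0 ?normc_ge0.
rewrite -(rE (fun j b => w j * normc (x j b ord0))) summxE.
apply: le_trans (ler_normc_sum _ _ _) _; apply: ler_sum => j _.
exact: normc_mulmx_le.
Qed.

Lemma cvg_sqr_vnorm n (u : nat -> 'cV[R[i]]_n) (v : 'cV[R[i]]_n) :
  u @ \oo --> v -> vnorm (u k) ^+ 2 @[k --> \oo] --> vnorm v ^+ 2.
Proof.
move=> /cvg_mxP uv; rewrite sqr_vnorm; under eq_fun do rewrite sqr_vnorm.
apply: cvg_sum => a _; rewrite sqr_normc_ReIm;
  under eq_fun do rewrite sqr_normc_ReIm.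
have /cvg_complexP[cRe cIm] := uv a ord0.
by apply: cvgD; apply: cvgM.
Qed.

(** The inner series are first truncated at [M]. Cauchy-Schwarz in each row costs one factor [W]
    through the row sums; exchanging the two finite sums costs the other through the column sums.
    The bound does not depend on [M], so it survives the limit. *)
Lemma Schur_test m n N (T : nat -> nat -> 'M[R[i]]_(m, n)) (w : nat -> nat -> R)
    (W S : R) (x : nat -> 'cV[R[i]]_n) (y : nat -> 'cV[R[i]]_m) :
  (forall i j a b, normc (T i j a b) <= w i j) -> (forall i j, 0 <= w i j) ->
  (forall i M, \sum_(0 <= j < M) w i j <= W) ->
  (forall j, \sum_(0 <= i < N) w i j <= W) ->
  (forall M, \sum_(0 <= j < M) vnorm (x j) ^+ 2 <= S) ->
  (forall i, series (fun j => T i j *m x j) @ \oo --> y i) ->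
  \sum_(0 <= i < N) vnorm (y i) ^+ 2 <= (m * n)%:R * W ^+ 2 * S.
Proof.
move=> Tw w0 row_W col_W xS Ty.
have W0 : 0 <= W by have := row_W 0 0; rewrite big_nil.
have cvg_sums : \sum_(0 <= i < N)
    vnorm (series (fun j => T i j *m x j) M) ^+ 2 @[M --> \oo] -->
    \sum_(0 <= i < N) vnorm (y i) ^+ 2.
  by apply: cvg_sum => i _; exact: cvg_sqr_vnorm.
apply: ler_cvg_to cvg_sums (@cvg_cst _ _ _ _ _) _; apply: nearW => M.
have row_le i : vnorm (series (fun j => T i j *m x j) M) ^+ 2 <=
    (m * n)%:R * W * \sum_(0 <= j < M) w i j * vnorm (x j) ^+ 2.
  apply: le_trans (vnorm_block_row_le _ _ (Tw i) (w0 i)) _.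
  rewrite ler_wpM2r ?ler_wpM2l//.
  by apply: sumr_ge0 => j _; rewrite mulr_ge0 ?sqr_ge0.
apply: le_trans (ler_sum _ (fun i _ => row_le i)) _.
rewrite -mulr_sumr expr2 mulrA -[leRHS]mulrA ler_wpM2l ?mulr_ge0//.
rewrite exchange_big_nat /=; apply: (@le_trans _ _ (W * \sum_(0 <= j < M) vnorm
  (x j) ^+ 2)).
  rewrite mulr_sumr; apply: ler_sum => j _.
  by rewrite -mulr_suml ler_wpM2r ?sqr_ge0.
by rewrite ler_wpM2l.
Qed.

(** Square summability bounds all [x j] uniformly by [Num.sqrt S], so the summable weights [w]
    dominate the series up to a constant. *)
Lemma cvgn_block_row m n (T : nat -> 'M[R[i]]_(m, n)) (w : nat -> R) (W : R)
    (x : nat -> 'cV[R[i]]_n) (S : R) :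
  (forall j a b, normc (T j a b) <= w j) -> (forall j, 0 <= w j) ->
  (forall M, \sum_(0 <= j < M) w j <= W) ->
  (forall M, \sum_(0 <= j < M) vnorm (x j) ^+ 2 <= S) ->
  cvgn (series (fun j => T j *m x j)).
Proof.
move=> Tw w0 wW xS.
have xle j : vnorm (x j) <= Num.sqrt S.
  rewrite -[leLHS]ger0_norm ?vnorm_ge0// -sqrtr_sqr ler_wsqrtr//.
  apply: le_trans (xS j.+1); rewrite big_nat_recr//= lerDr.
  by apply: sumr_ge0 => k _; rewrite sqr_ge0.
apply: (@cvgn_series_mx _ _ _ _ (fun j => n%:R * Num.sqrt S * w j)).
  move=> j a b; have -> : b = ord0 by exact: ord1.
  have /= H := normc_mulmx_le (x j) (Tw j a); apply: (le_trans H).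
  rewrite -mulrA [leRHS]mulr_natl -[n in leRHS]card_ord -sumr_const.
  apply: ler_sum => c _; rewrite mulrC ler_wpM2r//.
  exact: le_trans (normc_le_vnorm _ _) (xle j).
apply: nondecreasing_is_cvgn.
  apply: nondecreasing_series => j _ _; rewrite mulr_ge0// mulr_ge0//.
exists (n%:R * Num.sqrt S * W) => _ [M _ <-].
rewrite /series/= -mulr_sumr ler_wpM2l// mulr_ge0//.
Qed.

(** * The extended-valued norm and bounds on finite sections *)

Lemma l2norm_fin n (x : nat -> 'cV[R[i]]_n) : (l2norm x < +oo)%E ->
  exists2 S : R, l2norm x = (Num.sqrt S)%:E &
    forall M, \sum_(0 <= j < M) vnorm (x j) ^+ 2 <= S.
Proof.
rewrite /l2norm; set s := (\sum_(0 <= k <oo) _)%E => s_fin.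
have sM M : ((\sum_(0 <= j < M) vnorm (x j) ^+ 2)%:E <= s)%E.
  rewrite -sumEFin; apply: (@nneseries_lim_ge _ _ xpredT 0%N) => j _ _.
  by rewrite lee_fin sqr_ge0.
case: s s_fin sM => [S| |] // s_fin sM.
  by exists S => // M; rewrite -lee_fin.
(* The value [-oo] is excluded by the empty partial sum. *)
by have := sM 0%N; rewrite leeNy_eq.
Qed.

Lemma l2norm_le n (y : nat -> 'cV[R[i]]_n) (S : R) :
  (forall N, \sum_(0 <= i < N) vnorm (y i) ^+ 2 <= S) ->
  (l2norm y <= (Num.sqrt S)%:E)%E.
Proof.
move=> yS; rewrite /l2norm; set s := (\sum_(0 <= k <oo) _)%E.
have : (s <= S%:E)%E.
  apply: lime_le; first by apply: is_cvg_nneseries => i _ _;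
    rewrite lee_fin sqr_ge0.
  by apply: nearW => N; rewrite sumEFin lee_fin.
by case: s => [s| |] //=; rewrite !lee_fin => sS; rewrite ler_wsqrtr.
Qed.

(** * Geometric weights with uniformly bounded row and column sums *)

Lemma geometric_sum_le (r : R) M : 0 < r -> r < 1 ->
  \sum_(0 <= k < M) r ^+ k <= (1 - r)^-1.
Proof.
move=> r0 r1; rewrite -[leRHS]mul1r.
apply: le_trans (@geometric_le_lim _ M _ _ ler01 r0 _);
  last by rewrite gtr0_norm.
by apply: ler_sum => k _; rewrite /= mul1r.
Qed.

(** The upper triangular profile of [scrA_block], with each block replaced by its expected geometric
    size. *)
Definition toeplitz_weight (r : R) (i j : nat) : R :=
  if (j < i)%N then 0 else r ^+ (j - i).

Lemma toeplitz_weight_ge0 r i j : 0 < r -> 0 <= toeplitz_weight r i j.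
Proof. by move=> r0; rewrite /toeplitz_weight; case: ifP => // _;
  rewrite exprn_ge0// ltW. Qed.

Lemma toeplitz_weight_row_sum r i M : 0 < r -> r < 1 ->
  \sum_(0 <= j < M) toeplitz_weight r i j <= (1 - r)^-1.
Proof.
move=> r0 r1; elim: M i => [|M IHM] i.
  by rewrite big_nil invr_ge0 subr_ge0 ltW.
case: i => [|i].
  apply: le_trans (geometric_sum_le M.+1 r0 r1).
  by apply: ler_sum => j _; rewrite /toeplitz_weight subn0.
(* The weights depend on [j - i] only: row [i.+1] is a zero followed by row [i]. *)
rewrite big_nat_recl//= {1}/toeplitz_weight /= add0r.
by apply: le_trans (IHM i); apply: ler_sum.
Qed.

Lemma toeplitz_weight_col_sum r j N : 0 < r -> r < 1 ->
  \sum_(0 <= i < N) toeplitz_weight r i j <= (1 - r)^-1.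
Proof.
move=> r0 r1; have r'0 : 0 < 1 - r by rewrite subr_gt0.
(* The sharper bound is the exact sum of the whole column, [1 + r + ... + r ^+ j]; unlike the
   uniform bound it passes through an induction on [j]. *)
suff H : \sum_(0 <= i < N) toeplitz_weight r i j <= (1 - r ^+ j.+1) / (1 - r).
  by apply: (le_trans H); rewrite ler_pdivrMr// mulVf ?gt_eqF//
    gerBl exprn_ge0// ltW.
elim: j N => [|j IHj] [|N].
- by rewrite big_nil expr1 divff ?gt_eqF.
- rewrite big_nat_recl// big1 => [|i _].
    by rewrite /toeplitz_weight/= expr1 divff ?gt_eqF// addr0.
  by rewrite /toeplitz_weight.
- by rewrite big_nil divr_ge0 ?(ltW r'0)// subr_ge0 exprn_ile1// ltW.
(* Column [j.+1] is its top entry [r ^+ j.+1] followed by column [j]. *)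
rewrite big_nat_recl//; apply: le_trans (lerD (lexx _) (IHj N)) _.
rewrite /toeplitz_weight /= subn0 ler_pdivlMr// mulrDl divfK ?gt_eqF//.
by rewrite [r ^+ j.+2]exprS; lra.
Qed.

(** * From the spectral radius to entrywise decay of the powers of [D] *)

Lemma has_ubound_opnorm m n (M : 'M[R[i]]_(m, n)) :
  has_ubound [set vnorm (M *m v) | v in [set v : 'cV[R[i]]_n | vnorm v <= 1]].
Proof.
(* Coordinates of a vector of the unit ball have modulus at most 1, so coordinate [a] of the image
   is at most the sum of the moduli in row [a]. *)
exists (Num.sqrt (\sum_(a < m) (\sum_(b < n) normc (M a b)) ^+ 2)) => _ [v /=
  v1 <-].
rewrite ler_wsqrtr//; apply: ler_sum => a _.
rewrite ler_sqr ?nnegrE ?normc_ge0 ?sumr_ge0// => [|b _]; last exact: normc_ge0.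
rewrite mxE; apply: le_trans (ler_normc_sum _ _ _) _; apply: ler_sum => b _.
rewrite Normc.normcM ler_piMr ?normc_ge0//.
exact: le_trans (normc_le_vnorm _ _) v1.
Qed.

Lemma normc_le_opnorm m n (M : 'M[R[i]]_(m, n)) a b : normc (M a b) <= opnorm M.
Proof.
have e1 : vnorm (delta_mx b ord0 : 'cV[R[i]]_n) <= 1.
  rewrite -[leRHS]sqrtr1 ler_wsqrtr// (bigD1 b)//= big1 => [|c cb].
    by rewrite mxE !eqxx Normc.normc1 expr1n addr0.
  by rewrite mxE (negPf cb) Normc.normc0 expr0n.
apply: (@le_trans _ _ (vnorm (M *m delta_mx b ord0 : 'cV[R[i]]_m))).
  by apply: le_trans (normc_le_vnorm _ a); rewrite -colE mxE.
by apply: ub_le_sup; [exact: has_ubound_opnorm|exists (delta_mx b ord0)].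
Qed.

(** This is the root test: for [l < r < 1], eventually [opnorm (D ^+ k) <= r ^+ k], and the finitely
    many earlier powers are absorbed into [K]. *)
Lemma expmx_entries_decay p (D : 'M[R[i]]_p) (l : R) :
  opnorm (D ^+ k) `^ (k%:R^-1) @[k --> \oo] --> l -> l < 1 ->
  exists r K : R, [/\ 0 < r, r < 1, 0 <= K &
    forall k a b, normc ((D ^+ k) a b) <= K * r ^+ k].
Proof.
(* The midpoint of [l] and 1 lies strictly between them; the maximum with [1 / 2] makes [r] positive
   without first locating [l]. *)
move=> Dl l1; pose r : R := Num.max ((l + 1) / 2) (1 / 2).
have r0 : 0 < r by rewrite lt_max; apply/orP; right; lra.
have r1 : r < 1 by rewrite gt_max; apply/andP; split; lra.
have lr : l < r by rewrite lt_max; apply/orP; left; lra.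
have [N _ DN] := cvgr_lt _ Dl _ lr.
pose f k := \sum_(a < p) \sum_(b < p) normc ((D ^+ k) a b) / r ^+ k.
have f0 k : 0 <= f k.
  apply: sumr_ge0 => a _; apply: sumr_ge0 => b _.
  by rewrite divr_ge0 ?normc_ge0// exprn_ge0// ltW.
(* In [K], the term 1 serves the powers beyond [N], and the sum of the rescaled entries serves those
   up to [N]. *)
exists r, (1 + \sum_(0 <= k < N.+1) f k); split => // [|k a b].
  by rewrite addr_ge0// sumr_ge0.
rewrite -ler_pdivrMr ?exprn_gt0//.
have [kN|Nk] := leqP k N.
  apply: (@le_trans _ _ (f k)).
    rewrite /f (bigD1 a)//= (bigD1 b)//= -addrA lerDl addr_ge0 ?sumr_ge0//
      => c _.
      by rewrite divr_ge0 ?normc_ge0// exprn_ge0// ltW.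
    by rewrite sumr_ge0// => d _; rewrite divr_ge0 ?normc_ge0// exprn_ge0// ltW.
  rewrite (bigD1_seq k) ?mem_index_iota ?iota_uniq ?ltnS//= addrCA lerDl.
  by rewrite addr_ge0// sumr_ge0.
apply: le_trans (_ : 1 <= _); last by rewrite lerDl sumr_ge0.
rewrite ler_pdivrMr ?exprn_gt0// mul1r.
have op0 : 0 <= opnorm (D ^+ k) by apply: le_trans (normc_le_opnorm _ a b);
  exact: normc_ge0.
apply: le_trans (normc_le_opnorm _ a b) _.
(* Recovering the norm from its [k]-th root requires a nonzero [k], which [N < k] provides. *)
have k0 : (k%:R : R) != 0 by rewrite pnatr_eq0 -lt0n (leq_ltn_trans _ Nk).
have -> : opnorm (D ^+ k) = (opnorm (D ^+ k) `^ k%:R^-1) ^+ k.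
  by rewrite -powR_mulrn ?powR_ge0// -powRrM mulVf// powRr1.
by rewrite lerXn2r ?nnegrE ?powR_ge0 ?(ltW r0)// ltW// DN//= ltnW.
Qed.

(** * Boundedness of operators with entrywise dominated blocks *)

Definition entry_sum m n (M : 'M[R[i]]_(m, n)) : R :=
  \sum_(a < m) \sum_(b < n) normc (M a b).

Lemma entry_sum_ge0 m n (M : 'M[R[i]]_(m, n)) : 0 <= entry_sum M.
Proof. by do 2![apply: sumr_ge0 => ? _]; exact: normc_ge0. Qed.

Lemma normc_le_entry_sum m n (M : 'M[R[i]]_(m, n)) a b :
  normc (M a b) <= entry_sum M.
Proof.
rewrite /entry_sum (bigD1 a)//= (bigD1 b)//= -addrA lerDl.
by rewrite addr_ge0// sumr_ge0// => *; rewrite ?sumr_ge0// => *;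
  exact: normc_ge0.
Qed.

Lemma normc_mulmx_entry_le m n q (M : 'M[R[i]]_(m, n)) (N : 'M[R[i]]_(n, q))
    (v w : R) a b :
  (forall c, normc (M a c) <= v) -> (forall c, normc (N c b) <= w) ->
  normc ((M *m N) a b) <= n%:R * (v * w).
Proof.
move=> Mv Nw; rewrite mxE; apply: le_trans (ler_normc_sum _ _ _) _.
rewrite [leRHS]mulr_natl -[n in leRHS]card_ord -sumr_const.
by apply: ler_sum => c _; rewrite Normc.normcM ler_pM ?normc_ge0.
Qed.

Lemma row_defined_summable m n (T : nat -> 'M[R[i]]_(m, n)) (w : nat -> R)
    (W : R) :
  (forall j a b, normc (T j a b) <= w j) -> (forall j, 0 <= w j) ->
  (forall M, \sum_(0 <= j < M) w j <= W) -> row_defined T.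
Proof. by move=> Tw w0 wW x /l2norm_fin[S _ xS];
  exact: cvgn_block_row Tw w0 wW xS. Qed.

(** Since [limn] is meaningful only on convergent sequences, linearity comes from [row_defined] and
    uniqueness of limits. *)
Lemma row_apply_linear m n (T : nat -> 'M[R[i]]_(m, n)) (z : R[i])
    (x y : nat -> 'cV[R[i]]_n) : row_defined T ->
  (l2norm x < +oo)%E -> (l2norm y < +oo)%E ->
  row_apply T (z *: x + y) = z *: row_apply T x + row_apply T y.
Proof.
move=> Tdef xfin yfin.
have Txy : series (fun j => T j *m (z *: x + y) j) @ \oo -->
    z *: row_apply T x + row_apply T y.
  have -> : series (fun j => T j *m (z *: x + y) j) = (fun M =>
      z *: series (fun j => T j *m x j) M + series (fun j => T j *m y j) M).
    apply/funext => M; rewrite /series/= scaler_sumr -big_split.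
    by apply: eq_bigr => j _; rewrite mulmxDr -scalemxAr.
  exact: cvg_mx_linear (Tdef _ xfin) (Tdef _ yfin).
have cvg_Txy : cvgn (series (fun j => T j *m (z *: x + y) j)).
  by apply/cvg_ex; eexists; exact: Txy.
exact (cvg_mx_unique cvg_Txy Txy).
Qed.

Lemma bounded_row_operator m n (T : nat -> 'M[R[i]]_(m, n)) (w : nat -> R)
    (W : R) :
  (forall j a b, normc (T j a b) <= w j) -> (forall j, 0 <= w j) ->
  (forall M, \sum_(0 <= j < M) w j <= W) ->
  bounded_operator (@l2norm R n) (@vnorme R m) (row_apply T).
Proof.
move=> Tw w0 wW; have Tdef := row_defined_summable Tw w0 wW.
split=> [z x y|]; first exact: row_apply_linear.
exists (Num.sqrt ((m * n)%:R * W ^+ 2)) => x xfin.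
have [S xE xS] := l2norm_fin xfin.
(* The row is treated as a section with [N = 1]; a column sum is then a single weight, bounded by a
   partial row sum. *)
have := @Schur_test m n 1 (fun=> T) (fun=> w) W S x (fun=> row_apply T x)
  (fun=> Tw)
  (fun=> w0) (fun=> wW) _ xS (fun=> Tdef _ xfin).
rewrite !big_nat1 => H; rewrite xE /vnorme -EFinM lee_fin -sqrtrM; last first.
  by rewrite mulr_ge0// sqr_ge0.
rewrite -[leLHS]ger0_norm ?vnorm_ge0// -sqrtr_sqr ler_wsqrtr// H// => j.
rewrite big_nat1; apply: le_trans (wW j.+1); rewrite big_nat_recr//= lerDr.
exact: sumr_ge0.
Qed.

Lemma bounded_block_operator m n (T : nat -> nat -> 'M[R[i]]_(m, n))
    (w : nat -> nat -> R) (W : R) :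
  (forall i j a b, normc (T i j a b) <= w i j) -> (forall i j, 0 <= w i j) ->
  (forall i M, \sum_(0 <= j < M) w i j <= W) ->
  (forall N j, \sum_(0 <= i < N) w i j <= W) ->
  bounded_operator (@l2norm R n) (@l2norm R m) (fun x i => row_apply (T i) x).
Proof.
move=> Tw w0 row_W col_W.
have Tdef i := row_defined_summable (Tw i) (w0 i) (row_W i).
split=> [z x y xfin yfin|].
  by apply/funext => i; rewrite row_apply_linear.
exists (Num.sqrt ((m * n)%:R * W ^+ 2)) => x xfin.
have [S xE xS] := l2norm_fin xfin.
rewrite xE -EFinM -sqrtrM; last by rewrite mulr_ge0// sqr_ge0.
apply: l2norm_le => N.
exact: Schur_test Tw w0 row_W (col_W N) xS (fun i => Tdef i _ xfin).
Qed.

Lemma bounded_column_operator m n (T : nat -> 'M[R[i]]_(m, n)) (w : nat -> R)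
    (W : R) :
  (forall j a b, normc (T j a b) <= w j) -> (forall j, 0 <= w j) ->
  (forall M, \sum_(0 <= j < M) w j <= W) ->
  bounded_operator (@vnorme R n) (@l2norm R m) (fun u k => T k *m u).
Proof.
move=> Tw w0 wW; split=> [z x y _ _|].
  by apply/funext => k /=; rewrite mulmxDr -scalemxAr.
exists (Num.sqrt ((m * n)%:R * W ^+ 2)) => x _.
rewrite /vnorme -[vnorm x]ger0_norm ?vnorm_ge0// -sqrtr_sqr -EFinM -sqrtrM;
  last first.
  by rewrite mulr_ge0// sqr_ge0.
apply: l2norm_le => N.
have w_W k : w k <= W.
  apply: le_trans (wW k.+1); rewrite big_nat_recr//= lerDr; exact: sumr_ge0.
(* Cauchy-Schwarz for a single block gives the factor [w k ^+ 2]. Only one of the two copies is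
   replaced by [W]; the other is kept so that the sum over [k] converges. *)
have kle k : vnorm (T k *m x) ^+ 2 <= (m * n)%:R * vnorm x ^+ 2 * W * w k.
  have := @vnorm_block_row_le m n (fun=> T k) (fun=> x) (fun=> w k) 1 (fun=> Tw
    k) (fun=> w0 k).
  rewrite !big_nat1 => /le_trans; apply.
  have -> : (m * n)%:R * vnorm x ^+ 2 * W * w k =
      (m * n)%:R * W * (w k * vnorm x ^+ 2) by ring.
  by rewrite ler_wpM2r ?ler_wpM2l// mulr_ge0 ?sqr_ge0.
apply: le_trans (ler_sum _ (fun k _ => kle k)) _.
have -> : (m * n)%:R * W ^+ 2 * vnorm x ^+ 2 =
    (m * n)%:R * vnorm x ^+ 2 * W * W by ring.
rewrite -mulr_sumr ler_wpM2l// mulr_ge0//;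
  last exact: le_trans (w0 0%N) (w_W 0%N).
by rewrite mulr_ge0 ?sqr_ge0.
Qed.

Lemma normc_unit_circle (z : R[i]) : `|z| = 1 -> normc z = 1.
Proof. by move=> z1; have := congr1 (@complex.Re R) z1. Qed.

(** * Neumann series, block bounds and the symbol under geometric decay *)

Section GeometricDecay.
Variables (p : nat) (D : 'M[R[i]]_p) (r K : R).
Hypotheses (r0 : 0 < r) (r1 : r < 1) (K0 : 0 <= K).
Hypothesis decay : forall k a b, normc ((D ^+ k) a b) <= K * r ^+ k.

(** The partial sums times [1%:M - z *: D] telescope to [1%:M - z ^+ M *: D ^+ M], and the last term
    vanishes in the limit since [|z| = 1] leaves the decay of [D ^+ M] intact. *)
Lemma Neumann_series (z : R[i]) : `|z| = 1 ->
  1%:M - z *: D \in unitmx /\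
  series (fun k => z ^+ k *: D ^+ k) @ \oo --> invmx (1%:M - z *: D).
Proof.
move=> /normc_unit_circle z1.
have zDle k a b : normc ((z ^+ k *: D ^+ k) a b) <= K * r ^+ k.
  rewrite mxE Normc.normcM; have -> : normc (z ^+ k) = 1.
    by elim: k => [|k IHk]; rewrite ?expr0 ?Normc.normc1//
      exprS Normc.normcM z1 IHk mulr1.
  by rewrite mul1r.
have r1' : `|r| < 1 by rewrite gtr0_norm.
have cS : cvgn (series (fun k => z ^+ k *: D ^+ k)).
  by apply: cvgn_series_mx zDle _; exact: is_cvg_geometric_series.
set G := limn (series (fun k => z ^+ k *: D ^+ k)) in cS *.
have telescope M : series (fun k => z ^+ k *: D ^+ k) M *m (1%:M - z *: D) =
    1%:M - z ^+ M *: D ^+ M.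
  elim: M => [|M IHM].
    by rewrite /series/= big_nil mul0mx !expr0 scale1r subrr.
  rewrite /series/= big_nat_recr//= mulmxDl [X in X + _]IHM mulmxBr mulmx1.
  rewrite -scalemxAl -scalemxAr scalerA -exprSr.
  have -> : D ^+ M *m D = D ^+ M.+1 by rewrite exprSr.
  by rewrite addrA subrK.
have GE : G *m (1%:M - z *: D) = 1%:M.
  have cG : (fun M => series (fun k => z ^+ k *: D ^+ k) M *m (1%:M - z *: D))
    @ \oo
      --> G *m (1%:M - z *: D) by apply: cvg_mulmx cS _; exact: cvg_cst.
  apply: cvg_mx_unique cG _; apply/cvg_mxP => a b; apply/cvg_normcP.
  apply: squeeze_cvgr (@cvg_cst _ _ _ _ _) (cvg_geometric K r1').
  near=> k; rewrite normc_ge0 telescope.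
  have -> : (1%:M : 'M[R[i]]_p) a b - (1%:M - z ^+ k *: D ^+ k) a b =
      (z ^+ k *: D ^+ k) a b by rewrite !mxE opprB addrC subrK.
  exact: zDle.
(* A left inverse of a square matrix is a two-sided inverse. *)
have [_ Du] := mulmx1_unit GE.
have -> : invmx (1%:M - z *: D) = G.
  by rewrite -[RHS](mulmxK Du) GE mul1mx.
by split; [exact: Du|exact: cS].
Unshelve. all: by end_near. Qed.

Lemma normc_mulmx_pow_le n (B : 'M[R[i]]_(n, p)) k a b :
  normc ((B *m D ^+ k) a b) <= p%:R * (entry_sum B * K) * r ^+ k.
Proof.
rewrite -!mulrA; apply: normc_mulmx_entry_le => c; last exact: decay.
exact: normc_le_entry_sum.
Qed.

Lemma normc_pow_mulmx_le n (C : 'M[R[i]]_(p, n)) k a b :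
  normc ((D ^+ k *m C) a b) <= p%:R * (K * entry_sum C) * r ^+ k.
Proof.
rewrite -!mulrA [_ * r ^+ k]mulrC [K * _]mulrA.
by apply: normc_mulmx_entry_le => c; [exact: decay|exact: normc_le_entry_sum].
Qed.

(** A block above the diagonal contains [D ^+ (j - i).-1], one power short of the weight
    [r ^+ (j - i)]; hence the division by [r]. The summand [entry_sum A] covers the diagonal. *)
Lemma normc_scrA_block_le n (A : 'M[R[i]]_n) (B : 'M[R[i]]_(n, p))
    (C : 'M[R[i]]_(p, n)) i j a b :
  normc (scrA_block A B C D i j a b) <=
  (entry_sum A + p%:R * (p%:R * (entry_sum B * K) * entry_sum C) / r) *
    toeplitz_weight r i j.
Proof.
have H0 : 0 <= p%:R * (p%:R * (entry_sum B * K) * entry_sum C) / r.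
  by rewrite divr_ge0 ?(ltW r0)// !mulr_ge0 ?entry_sum_ge0.
rewrite /scrA_block /toeplitz_weight; case: ltngtP => [ji|ij|<-].
- by rewrite mxE Normc.normc0 mulr0.
- apply: le_trans (normc_mulmx_entry_le (fun c => normc_mulmx_pow_le _ _ _ _)
    (fun c => normc_le_entry_sum _ _ _)) _.
  rewrite mulrDl -[leLHS]add0r lerD ?mulr_ge0 ?entry_sum_ge0//.
    by rewrite exprn_ge0// ltW.
  case: (j - i)%N (subn_gt0 i j) => [|k _] /=; first by rewrite ij.
  rewrite exprS [_ / r * _]mulrA divfK ?gt_eqF//; lra.
rewrite subnn expr0 mulr1.
by apply: le_trans (normc_le_entry_sum _ _ _) _; rewrite lerDl.
Qed.

Lemma scrA_symbol n (A : 'M[R[i]]_n) (B : 'M[R[i]]_(n, p))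
    (C : 'M[R[i]]_(p, n)) (z : R[i]) : `|z| = 1 ->
  series (fun k => z ^+ k *: scrA_block A B C D 0 k) @ \oo -->
  A + z *: (B *m invmx (1%:M - z *: D) *m C).
Proof.
move=> z1; have [_ cN] := Neumann_series z1.
(* Shifting the partial sums by one isolates the constant term [A]; a factor [z] comes out of the
   remaining terms and leaves the Neumann series. *)
rewrite -cvg_shiftS.
have -> : (fun M => series (fun k => z ^+ k *: scrA_block A B C D 0 k) M.+1) =
    fun M => z *: (B *m series (fun k => z ^+ k *: D ^+ k) M *m C) + A.
  apply/funext => M; rewrite /series/= big_nat_recl// expr0 scale1r addrC.
  congr (_ + _); rewrite mulmx_sumr mulmx_suml scaler_sumr.
  apply: eq_bigr => k _.
  by rewrite /scrA_block /= -scalemxAr -scalemxAl scalerA -exprS.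
rewrite addrC; apply: cvg_mx_linear (cvg_cst _).
by apply: cvg_mulmx (cvg_cst _); apply: cvg_mulmx cN; exact: cvg_cst.
Qed.

End GeometricDecay.

End Estimates.

(** * Boundedness of the three operators and the Toeplitz structure *)

Theorem theorem3p1 (R : realType) (n p : nat)
    (A : 'M[R[i]]_n) (B : 'M[R[i]]_(n, p))
    (C : 'M[R[i]]_(p, n)) (D : 'M[R[i]]_p)
    (hM : forall z : R[i], `|z| = 1 -> z%:M - A \in unitmx ->
       opnorm (D + C *m invmx (z%:M - A) *m B) <= 1)
    (hD : exists2 l : R,
       (opnorm (D ^+ k) `^ (k%:R^-1) @[k --> \oo] --> l) & l < 1) :
  ([/\ (forall i : nat, row_defined (scrA_block A B C D i)),
       row_defined (scrC_block C D),
       bounded_operator (@l2norm R n) (@l2norm R n) (scrA A B C D),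
       bounded_operator (@vnorme R p) (@l2norm R n) (scrB B D) &
       bounded_operator (@l2norm R n) (@vnorme R p) (scrC C D)]) /\
  ((forall z : R[i], `|z| = 1 -> 1%:M - z *: D \in unitmx) /\
   is_block_toeplitz
     (fun z => A + z *: (B *m invmx (1%:M - z *: D) *m C)) (scrA A B C D)).
Proof.
have [l Dl l1] := hD; have [r [K [r0 r1 K0 decay]]] := expmx_entries_decay Dl
  l1.
have geo_ge0 c k : 0 <= c -> 0 <= c * r ^+ k by move=> c0;
  rewrite mulr_ge0// exprn_ge0// ltW.
have geo_sum c M : 0 <= c -> \sum_(0 <= k < M) c * r ^+ k <= c * (1 - r)^-1.
  by move=> c0; rewrite -mulr_sumr ler_wpM2l// geometric_sum_le.
pose cA := entry_sum A + p%:R * (p%:R * (entry_sum B * K) * entry_sum C) / r.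
have cA0 : 0 <= cA.
  by rewrite addr_ge0 ?divr_ge0 ?(ltW r0) ?mulr_ge0 ?entry_sum_ge0.
have cB0 : 0 <= p%:R * (entry_sum B * K) by rewrite !mulr_ge0 ?entry_sum_ge0.
have cC0 : 0 <= p%:R * (K * entry_sum C) by rewrite !mulr_ge0 ?entry_sum_ge0.
have A_le := normc_scrA_block_le r0 K0 decay A B C.
have A_ge0 i j : 0 <= cA * toeplitz_weight r i j.
  by rewrite mulr_ge0// toeplitz_weight_ge0.
have A_row i M : \sum_(0 <= j < M) cA * toeplitz_weight r i j <= cA * (1 -
  r)^-1.
  by rewrite -mulr_sumr ler_wpM2l// toeplitz_weight_row_sum.
have A_col N j : \sum_(0 <= i < N) cA * toeplitz_weight r i j <= cA * (1 -
  r)^-1.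
  by rewrite -mulr_sumr ler_wpM2l// toeplitz_weight_col_sum.
have A_def i := row_defined_summable (A_le i) (A_ge0 i) (A_row i).
split; split.
- exact: A_def.
- exact: row_defined_summable (normc_pow_mulmx_le decay C) (fun k => geo_ge0 _
    k cC0)
    (fun M => geo_sum _ M cC0).
- exact: bounded_block_operator A_le A_ge0 A_row A_col.
- exact: bounded_column_operator (normc_mulmx_pow_le decay B) (fun k => geo_ge0
    _ k cB0)
    (fun M => geo_sum _ M cB0).
- exact: bounded_row_operator (normc_pow_mulmx_le decay C) (fun k => geo_ge0 _
    k cC0)
    (fun M => geo_sum _ M cC0).
- by move=> z z1; have [] := Neumann_series r0 r1 decay z1.
(* The Fourier coefficients are read off the top block row of [scrA]; the negative ones vanish
   because the operator is upper triangular. *)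
exists (fun k : int => if k is Posz k' then scrA_block A B C D 0 k' else 0).
  move=> z z1; exists (A + z *: (B *m invmx (1%:M - z *: D) *m C)), 0.
  split; last by rewrite addr0.
    exact (@scrA_symbol _ _ _ _ _ r0 r1 decay _ A B C z z1).
  have -> : series (fun k : nat => z ^- k.+1 *: (0 : 'M[R[i]]_n)) = fun=> 0.
    by apply/funext => M; rewrite /series/= big1// => k _; rewrite scaler0.
  exact: cvg_cst.
(* Row convergence is convergence to [limn], that is, to [scrA A B C D x i]; it remains to identify
   the coefficient at [j - i] with the block [(i, j)]. *)
move=> x xfin i; have := A_def i x xfin.
congr (cvgn (series _)); apply/funext => j; congr (_ *m _).
rewrite /scrA_block; case: (ltnP j i) => [ji|ij].
  (* [Negz k] stands for [- k.+1], hence the predecessor; in this form the coefficient reduces to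
     0. *)
  have -> : j%:Z - i%:Z = Negz (i - j).-1; last by [].
  by rewrite NegzE prednK ?subn_gt0// -subzn ?opprB// ltnW.
by rewrite subzn//= subn0 subn_eq0 eqn_leq ij andbT.
Qed.
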